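(* Let $u$ be the solution of $$u_t=u_{xx},\quad 0<x<a,\ 0<t<T,$$ $$u_x(0,t)=u^{-p}(0,t),\quad u_x(a,t)=(1-u(a,t))^{-q},\quad 0<t<T,$$ $$u(x,0)=u_0(x),\quad 0\le x\le a,$$ with quenching time $T$. If $u_0$ satisfies $$u_{xx}(x,0)\ge 0\quad\text{and}\quad u_x(x,0)\ge \frac{x}{a}\,(1-u(x,0))^{-q}\qquad\text{for } 0<x<a,$$ then there exists a positive constant $C_2$ such that $$u(a,t)\ge 1-C_2(T-t)^{1/(2q+2)}$$ for $t$ sufficiently close to the quenching time $T$.
   Context: Standing assumptions: $a,p,q>0$ are constants. The initial function $u_0$ is a non-negative smooth function on $[0,a]$ satisfying the compatibility conditions $u_0'(0)=u_0^{-p}(0)$ and $u_0'(a)=(1-u_0(a))^{-q}$. The quenching time of the solution is the finite time $T=T(u_0)<\infty$ such that $\lim_{t\to T^-}\min\{u(x,t):0\le x\le a\}=0$ or $\lim_{t\to T^-}\max\{u(x,t):0\le x\le a\}=1$. *)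

(* Defs.v *)
From HB Require Import structures.
From mathcomp Require Import all_boot all_order all_algebra.
From mathcomp Require Import all_classical all_reals all_analysis.

Set Implicit Arguments.
Unset Strict Implicit.
Unset Printing Implicit Defensive.

Import Order.TTheory GRing.Theory Num.Theory.
Import numFieldNormedType.Exports.

Local Open Scope classical_set_scope.
Local Open Scope ring_scope.

(* Differentiation relative to a set [A]: for [A] = `[0, a] this is the usual
   derivative at interior points and the one-sided derivative at 0 and a; the
   values at points of [A] depend only on the restriction of [f] to [A].
   The library's [derive1] is two-sided, hence unsuitable at 0 and a. *)
Definition diff_quot (R : realType) (f : R -> R) (x : R) : R -> R :=
  fun y => (f y - f x) / (y - x).

Definition derivable_on (R : realType) (A : set R) (f : R -> R) : Prop :=
  forall x, A x -> cvg (diff_quot f x @ within A x^').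

Definition derive_on (R : realType) (A : set R) (f : R -> R) (x : R) : R :=
  lim (diff_quot f x @ within A x^').

Definition smooth_on (R : realType) (A : set R) (f : R -> R) : Prop :=
  forall n : nat, derivable_on A (iter n (derive_on A) f).

(* u x t : space variable first; spatial derivatives are taken on [0, a]. *)
Definition d_x (R : realType) (a : R) (u : R -> R -> R) (x t : R) : R :=
  derive_on `[0, a] (u^~ t) x.

Definition d_xx (R : realType) (a : R) (u : R -> R -> R) (x t : R) : R :=
  derive_on `[0, a] ((d_x a u)^~ t) x.

Definition d_t (R : realType) (u : R -> R -> R) (x t : R) : R :=
  derive1 (u x) t.

(* [0 < u0 0] and [u0 a < 1] are what gives a meaning to the negative powers
   ([powR] is total, with junk values on nonpositive bases). *)
Record admissible_initial (R : realType) (a p q : R) (u0 : R -> R) : Prop := {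
  initial_smooth : smooth_on `[0, a] u0;
  initial_ge0 : forall x, 0 <= x <= a -> 0 <= u0 x;
  initial_gt0_left : 0 < u0 0;
  initial_lt1_right : u0 a < 1;
  compat_left : derive_on `[0, a] u0 0 = u0 0 `^ (- p);
  compat_right : derive_on `[0, a] u0 a = (1 - u0 a) `^ (- q)
}.

(* Classical solution on [0, a] x [0, T): u and u_x are continuous down to
   t = 0 (which the compatibility conditions allow), and u_t, u_xx are
   continuous up to the lateral boundary for t > 0. *)
Record classical_solution (R : realType) (a p q : R) (u0 : R -> R) (T : R)
    (u : R -> R -> R) : Prop := {
  sol_cont : {within `[0, a] `*` `[0, T[, continuous (fun z => u z.1 z.2)};
  sol_derivable_x :
    forall t, 0 <= t < T -> derivable_on `[0, a] (u^~ t);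
  sol_cont_x :
    {within `[0, a] `*` `[0, T[, continuous (fun z => d_x a u z.1 z.2)};
  sol_derivable_xx :
    forall t, 0 < t < T -> derivable_on `[0, a] ((d_x a u)^~ t);
  sol_cont_xx :
    {within `[0, a] `*` `]0, T[, continuous (fun z => d_xx a u z.1 z.2)};
  sol_derivable_t :
    forall x t, 0 <= x <= a -> 0 < t < T -> derivable (u x) t 1;
  sol_cont_t :
    {within `[0, a] `*` `]0, T[, continuous (fun z => d_t u z.1 z.2)};
  sol_heat :
    forall x t, 0 < x < a -> 0 < t < T -> d_t u x t = d_xx a u x t;
  sol_gt0_left : forall t, 0 < t < T -> 0 < u 0 t;
  sol_lt1_right : forall t, 0 < t < T -> u a t < 1;
  sol_flux_left :
    forall t, 0 < t < T -> d_x a u 0 t = u 0 t `^ (- p);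
  sol_flux_right :
    forall t, 0 < t < T -> d_x a u a t = (1 - u a t) `^ (- q);
  sol_initial : forall x, 0 <= x <= a -> u x 0 = u0 x
}.

(* By compactness of [0, a] and continuity of u, inf and sup are the minimum
   and the maximum. *)
Definition min_x (R : realType) (a : R) (u : R -> R -> R) (t : R) : R :=
  inf [set u x t | x in `[0, a]].

Definition max_x (R : realType) (a : R) (u : R -> R -> R) (t : R) : R :=
  sup [set u x t | x in `[0, a]].

Definition quenches_at (R : realType) (a : R) (u : R -> R -> R) (T : R) : Prop :=
  (min_x a u t @[t --> T^'-] --> (0 : R)) \/
  (max_x a u t @[t --> T^'-] --> (1 : R)).

(* Main.v *)
(* Doubling of variables replaces the maximum principle for derivatives of [u]:
   if [g y t - g x t] has a negative minimum over [0 <= x <= y <= a], then there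
   [g_x] vanishes at both points and [g_xx x <= 0 <= g_xx y], contradicting
   the sign of [g_t y - g_t x]. With [g] a perturbation of [u] this gives
   [u_x >= 0]; with [g = - (1 - u)^(q+1) / (q+1) - x^2 / (2 a)] it gives
   [u_x >= (x / a) (1 - u)^(-q)]. This [g] has zero [x]-derivative at [x = a],
   so its second derivative there is nonpositive, which bounds [u_t (a, t)] by
   [(1 - u)^(-q) / a + q (1 - u)^(-2q-1)]; hence
   [(1 - u (a, t))^(2q+2) + C t] is nondecreasing. The convex [u0] is a
   subsolution, so [u (0, t) >= u0 0 > 0]: quenching can only mean
   [u (a, t) -> 1], and letting the later time tend to [T] concludes. *)
Require Import Defs.
From mathcomp Require Import all_boot all_order all_algebra.
From mathcomp Require Import all_classical all_reals all_analysis.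
From mathcomp Require Import ring lra.

Import Order.TTheory GRing.Theory Num.Theory.
Import numFieldNormedType.Exports.

Local Open Scope classical_set_scope.
Local Open Scope ring_scope.

Set Implicit Arguments.
Unset Strict Implicit.
Unset Printing Implicit Defensive.

(** * Calculus of derivatives relative to a set *)

Definition deriv_within {R : realType} (A : set R) (f : R -> R) (x l : R) :=
  diff_quot f x y @[y --> within A x^'] --> l.

Section DerivWithin.
Context {R : realType}.
Implicit Types (A B : set R) (f g : R -> R) (x y l m a c : R).

Lemma cvg_near_eq (F : set_system R) (FF : Filter F) (f g : R -> R) l l' :
  l = l' ->
  f y @[y --> F] --> l -> (\forall y \near F, f y = g y) ->
  g y @[y --> F] --> l'.
Proof. by move=> <- fl fg; apply: cvg_trans fl; exact: near_eq_cvg. Qed.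

Lemma derivable_deriv_within A f x :
  derivable_on A f -> A x -> deriv_within A f x (derive_on A f x).
Proof. by move=> df Ax; exact: df. Qed.

Lemma deriv_withinP A f x l : deriv_within A f x l <->
  forall e : R, 0 < e -> exists2 d : R, 0 < d &
    forall y, A y -> y != x -> `|y - x| < d -> `|l - diff_quot f x y| < e.
Proof.
split=> [/cvgrPdist_lt h e e0|h].
- have /nbhs_ballP[d /= d0 hd] := h e e0.
  exists d => // y Ay yx yd; apply: hd => //=.
  by rewrite /ball /= distrC.
- apply/cvgrPdist_lt => e /h[d d0 hd].
  apply/nbhs_ballP; exists d => //= y; rewrite /ball/= => yx yneq Ay.
  by apply: hd => //; rewrite distrC.
Qed.

Lemma deriv_withinS A B f x l : A `<=` B ->
  deriv_within B f x l -> deriv_within A f x l.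
Proof.
move=> AB /deriv_withinP df; apply/deriv_withinP => e /df[d d0 hd].
by exists d => // y /AB; exact: hd.
Qed.

Lemma deriv_within_cont A f x l :
  deriv_within A f x l -> f y @[y --> within A x^'] --> f x.
Proof.
move=> h.
have h1 : (y - x) @[y --> within A x^'] --> (0 : R).
  apply/cvgrPdist_lt => e e0; apply/nbhs_ballP; exists e => //= y.
  by rewrite /ball/= sub0r normrN distrC.
apply: cvg_near_eq (cvgD (cvgM h h1) (cvg_cst (f x))) _.
  by rewrite mulr0 add0r.
near=> y; rewrite /= /diff_quot divfK ?subrK// subr_eq0.
by near: y; apply/nbhs_ballP; exists 1 => /=.
Unshelve. all: by end_near. Qed.

Lemma is_derive_deriv_within A f x l : is_derive x 1 f l ->
  deriv_within A f x l.
Proof.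
move=> [df fl]; apply/deriv_withinP => e e0.
have : h^-1 *: (f (h *: 1 + x) - f x) @[h --> 0^'] --> l by rewrite -fl;
  exact: df.
move=> /cvgrPdist_lt/(_ e e0)/nbhs_ballP[d /= d0 hd].
exists d => // y _ yx yd.
have := hd (y - x); rewrite /ball/= sub0r normrN subr_eq0 => /(_ yd yx).
rewrite /diff_quot [_ *: 1]mulr1 subrK.
by rewrite [_^-1 *: _]mulrC.
Qed.

Lemma deriv_within_is_derive A f x l : nbhs x A -> deriv_within A f x l ->
  is_derive x 1 f l.
Proof.
move=> /nbhs_ballP[r /= r0 hr] /deriv_withinP h.
have H : h^-1 *: (f (h *: 1 + x) - f x) @[h --> 0^'] --> l.
  apply/cvgrPdist_lt => e /h[d d0 hd].
  apply/nbhs_ballP; exists (Num.min d r); first by rewrite /= lt_min d0.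
  move=> k; rewrite /ball/= sub0r normrN lt_min => /andP[kd kr] k0.
  have := hd (k + x); rewrite /diff_quot addrK => /(_ _ _ kd).
  rewrite [_ *: 1]mulr1 [_^-1 *: _]mulrC; apply.
    by apply: hr; rewrite /ball/= opprD addrCA subrr addr0 normrN.
  by rewrite -subr_eq0 addrK.
split; first exact: (cvgP _ H).
exact/cvg_lim.
Qed.

Lemma deriv_withinD A f g x l m : deriv_within A f x l ->
  deriv_within A g x m ->
  deriv_within A (fun y => f y + g y) x (l + m).
Proof.
move=> hf hg; apply: cvg_near_eq erefl (cvgD hf hg) _.
by apply: nearW => y /=; rewrite /diff_quot; ring.
Qed.

Lemma deriv_withinN A f x l : deriv_within A f x l ->
  deriv_within A (fun y => - f y) x (- l).
Proof.
move=> hf; apply: cvg_near_eq erefl (cvgN hf) _.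
by apply: nearW => y /=; rewrite /diff_quot; ring.
Qed.

Lemma deriv_withinM A f g x l m : deriv_within A f x l ->
  deriv_within A g x m ->
  deriv_within A (fun y => f y * g y) x (l * g x + f x * m).
Proof.
move=> hf hg.
apply: cvg_near_eq erefl
  (cvgD (cvgM hf (deriv_within_cont hg)) (cvgM (cvg_cst (f x)) hg)) _.
by apply: nearW => y /=; rewrite /diff_quot; ring.
Qed.

Lemma deriv_within_comp A f g x l m : deriv_within A f x l ->
  is_derive (f x) 1 g m -> deriv_within A (g \o f) x (m * l).
Proof.
move=> hf hg.
(* The slope [s] extends the difference quotient of [g] continuously by [m] at [f x]. The quotient
   of [g \o f] is then the product of [s (f y)] and the quotient of [f], even at points where
   [f y = f x]. *)
pose s z := if z == f x then m else diff_quot g (f x) z.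
have sc : s z @[z --> f x] --> m.
  apply/cvgrPdist_lt => e e0.
  have /(is_derive_deriv_within setT)/deriv_withinP/(_ e e0)[d d0 hd] := hg.
  apply/nbhs_ballP; exists d => //= y; rewrite /ball/= distrC /s => yx.
  case: eqVneq => [_|yn]; first by rewrite subrr normr0.
  exact: hd.
apply: cvg_near_eq erefl (cvgM (cvg_comp _ _ (deriv_within_cont hf) sc) hf) _.
apply: nearW => y; rewrite /s /diff_quot /=.
case: eqVneq => [->|fn]; first by rewrite !subrr !mul0r mulr0.
by rewrite mulrA divfK// subr_eq0.
Qed.

(** The two image filters coincide, so their [lim] agree even if no limit exists; no
    differentiability has to be assumed. *)
Lemma derive_on_ext A f g x : (forall y, A y -> f y = g y) -> A x ->
  derive_on A f x = derive_on A g x.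
Proof.
move=> fg Ax; rewrite /derive_on.
suff -> : diff_quot f x @ within A x^' = diff_quot g x @ within A x^' by [].
have near_fg : \forall y \near within A x^', diff_quot f x y = diff_quot g x y.
  by apply/nbhs_ballP; exists 1 => //= y _ _ Ay; rewrite /diff_quot !fg.
by apply/seteqP; split; apply: near_eq_cvg; apply: filterS near_fg => y ->.
Qed.

Lemma deriv_within_ext A f g x l : (forall y, A y -> f y = g y) -> A x ->
  deriv_within A f x l -> deriv_within A g x l.
Proof.
move=> fg Ax /deriv_withinP df; apply/deriv_withinP => e /df[d d0 hd].
by exists d => // y Ay; have := hd y Ay; rewrite /diff_quot !fg.
Qed.

Lemma is_derive_powR_onem (r s : R) : s < 1 ->
  is_derive s 1 (fun z => (1 - z) `^ r) (- (r * (1 - s) `^ (r - 1))).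
Proof.
move=> s1; have s1' : 0 < 1 - s by rewrite subr_gt0.
have h : is_derive s 1 (fun z : R => 1 - z) (- 1).
  by apply: is_derive_eq; rewrite add0r mul1r.
rewrite -[- (r * _)]mulrN1.
have := @is_derive1_comp _ (fun z => z `^ r) (fun z =>
  1 - z) s _ _ (is_derive1_powR _ s1') h.
exact.
Qed.

End DerivWithin.

(** * One-sided derivative tests at a minimum, and the mean value theorem *)

Section MinimumTests.
Context {R : realType}.
Implicit Types (A : set R) (f : R -> R) (x y z l c r s : R).

Lemma deriv_within_min_left A f c x l : c < x -> `[c, x] `<=` A ->
  (forall y, c <= y <= x -> f x <= f y) -> deriv_within A f x l -> l <= 0.
Proof.
move=> cx cA fmin /deriv_withinP df; rewrite leNgt; apply/negP => l0.
have [d d0 hd] := df l l0.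
pose y := Num.max c (x - d / 2).
have yx : y < x by rewrite gt_max cx/=; lra.
have cy : c <= y by rewrite le_max lexx.
have dy : x - d / 2 <= y by rewrite le_max lexx orbT.
have Ay : A y by apply: cA; rewrite /= in_itv/= cy ltW.
have yd : `|y - x| < d by rewrite ltr_norml; apply/andP; split; lra.
have := hd y Ay (negbT (lt_eqF yx)) yd.
have : diff_quot f x y <= 0.
  by rewrite /diff_quot nmulr_lle0 ?invr_lt0 ?subr_lt0// subr_ge0 fmin// cy ltW.
by rewrite ltr_norml => h /andP[_]; lra.
Qed.

Lemma deriv_within_min_right A f x c l : x < c -> `[x, c] `<=` A ->
  (forall y, x <= y <= c -> f x <= f y) -> deriv_within A f x l -> 0 <= l.
Proof.
move=> cx cA fmin /deriv_withinP df; rewrite leNgt; apply/negP => l0.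
have [|d d0 hd] := df (- l); first by rewrite oppr_gt0.
pose y := Num.min c (x + d / 2).
have yx : x < y by rewrite lt_min cx/=; lra.
have cy : y <= c by rewrite ge_min lexx.
have dy : y <= x + d / 2 by rewrite ge_min lexx orbT.
have Ay : A y by apply: cA; rewrite /= in_itv/= cy (ltW yx).
have yd : `|y - x| < d by rewrite ltr_norml; apply/andP; split; lra.
have := hd y Ay (negbT (gt_eqF yx)) yd.
have : 0 <= diff_quot f x y.
  by rewrite /diff_quot divr_ge0 ?subr_ge0 ?fmin ?(ltW yx) ?cy.
by rewrite ltr_norml => h /andP[]; lra.
Qed.

Lemma deriv_within_continuous A f (f1 : R -> R) :
  (forall x, A x -> deriv_within A f x (f1 x)) -> {within A, continuous f}.
Proof.
move=> df; apply/subspace_continuousP => x Ax.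
apply/cvgrPdist_lt => e e0.
have /cvgrPdist_lt/(_ e e0)/nbhs_ballP[d /= d0 hd] :=
  deriv_within_cont (df x Ax).
apply/nbhs_ballP; exists d => //= y xy Ay.
have [->|yx] := eqVneq y x; first by rewrite subrr normr0.
exact: hd.
Qed.

Lemma deriv_within_MVT A f (f1 : R -> R) c x : c < x -> `[c, x] `<=` A ->
  (forall y, c <= y <= x -> deriv_within A f y (f1 y)) ->
  exists2 y, c < y < x & f x - f c = f1 y * (x - c).
Proof.
move=> cx cA df.
have [||y] := @MVT _ f f1 c x cx.
- move=> y; rewrite in_itv/= => /andP[cy yx].
  apply: (@deriv_within_is_derive _ A); last by apply: df; rewrite !ltW.
  apply: (@filterS _ _ _ `]c, x[).
    by move=> z /=; rewrite in_itv/= => /andP[? ?]; apply: cA;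
      rewrite /= in_itv/= !ltW.
  by apply: near_in_itvoo; rewrite in_itv/= cy.
- apply: (@deriv_within_continuous _ _ f1) => y; rewrite /= in_itv/= => /df h.
  exact: deriv_withinS h.
by rewrite in_itv/= => ? ?; exists y.
Qed.

(** If [l < 0], then [f1], which vanishes at [x], is positive just to the left of [x]. By the mean
    value theorem [f] takes smaller values there, against minimality. Only points left of [x] are
    used, so the test applies at the right end of the space interval too. *)
Lemma deriv_within_min_second A f (f1 : R -> R) c x l :
  c < x -> `[c, x] `<=` A ->
  (forall y, c <= y <= x -> deriv_within A f y (f1 y)) ->
  (forall y, c <= y <= x -> f x <= f y) -> f1 x = 0 ->
  deriv_within A f1 x l -> 0 <= l.
Proof.
move=> cx cA df fmin f1x /deriv_withinP df1; rewrite leNgt; apply/negP => l0.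
have [|d d0 hd] := df1 (- l); first by rewrite oppr_gt0.
pose y := Num.max c (x - d / 2).
have yx : y < x by rewrite gt_max cx/=; lra.
have cy : c <= y by rewrite le_max lexx.
have dy : x - d / 2 <= y by rewrite le_max lexx orbT.
have [||z /andP[yz zx] fz] := @deriv_within_MVT A f f1 y x yx.
- move=> z; rewrite /= in_itv/= => /andP[yz zx]; apply: cA.
  by rewrite /= in_itv/= zx (le_trans cy).
- by move=> z /andP[yz zx]; apply: df; rewrite zx (le_trans cy).
have Az : A z by apply: cA; rewrite /= in_itv/= !ltW// (le_lt_trans cy).
have zd : `|z - x| < d by rewrite ltr_norml; apply/andP; split; lra.
have := hd z Az (negbT (lt_eqF zx)) zd.
rewrite ltr_norml => /andP[h _].
have f1z : 0 < f1 z.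
  have : diff_quot f1 x z < 0 by lra.
  by rewrite /diff_quot f1x subr0 nmulr_llt0// invr_lt0 subr_lt0.
have := fmin y; rewrite cy (ltW yx) => /(_ erefl) fxy.
have : 0 < f x - f y by rewrite fz mulr_gt0// subr_gt0.
lra.
Qed.

Lemma deriv_within_nondecreasing A f (f1 : R -> R) c x :
  c <= x -> `[c, x] `<=` A ->
  (forall y, c <= y <= x -> deriv_within A f y (f1 y)) ->
  (forall y, c < y < x -> 0 <= f1 y) -> f c <= f x.
Proof.
rewrite le_eqVlt => /predU1P[->//|cx] cA df f1_ge0.
have [y cyx fcx] := deriv_within_MVT cx cA df.
by rewrite -subr_ge0 fcx mulr_ge0 ?f1_ge0// subr_ge0 ltW.
Qed.

Lemma powRN_lipschitz r c s z : 0 < r -> 0 < c -> c <= s <= z ->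
  s `^ (- r) - z `^ (- r) <= r * c `^ (- (r + 1)) * (z - s).
Proof.
move=> r0 c0 /andP[cs sz].
have s0 : 0 < s by exact: lt_le_trans cs.
have dpow y : s <= y <= z ->
    deriv_within `[s, z] (fun y => y `^ (- r)) y (- r * y `^ (- r - 1)).
  move=> /andP[sy _]; apply: is_derive_deriv_within.
  have := @is_derive1_powR _ (- r) y (lt_le_trans s0 sy); exact.
move: sz; rewrite le_eqVlt => /predU1P[->|sz]; first by rewrite !subrr mulr0.
have [//|y /andP[sy yz] E] := deriv_within_MVT sz _ dpow.
rewrite -opprB E -opprD mulNr mulNr opprK ler_wpM2r ?subr_ge0 ?(ltW sz)//.
rewrite ler_wpM2l ?(ltW r0)// !powRN lef_pV2 ?posrE ?powR_gt0//;
  last exact: lt_trans sy.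
have r1 : 0 <= r + 1 by lra.
have cy : c <= y by rewrite (le_trans cs) ?ltW.
by apply: ge0_ler_powR; rewrite // nnegrE ltW// (lt_le_trans c0).
Qed.

End MinimumTests.

(** * Continuity on slices and products *)

Lemma within_continuous_precomp {X Y Z : topologicalType} (A : set X) (B : set
  Y)
    (h : X -> Y) (f : Y -> Z) :
  continuous h -> {homo h : x / A x >-> B x} -> {within B, continuous f} ->
  {within A, continuous (f \o h)}.
Proof.
move=> ch hAB /subspace_continuousP cf; apply/subspace_continuousP => x Ax.
move=> P /(cf _ (hAB _ Ax)); rewrite /= !/nbhs/= => BP.
have : nbhs (h x) (fun y => B y -> P (f y)) by exact: BP.
by move/ch; apply: (@filterS _ (nbhs x)) => z /= hz /hAB /hz.
Qed.

Lemma continuous_pair {X Y Z : topologicalType} (f : X -> Y) (g : X -> Z) :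
  continuous f -> continuous g -> continuous (fun x => (f x, g x)).
Proof. by move=> cf cg x; exact: (cvg_pair (cf x) (cg x)). Qed.

(** * Propagation in time of monotonicity in space *)

Section MonotonicityPreservation.
Context {R : realType}.
Variables (a S : R) (g gx gxx gt : R -> R -> R).
Hypothesis a_gt0 : 0 < a.
Hypothesis S_ge0 : 0 <= S.
Hypothesis g_cont :
  {within `[0, a] `*` `[0, S], continuous (fun z : R * R => g z.1 z.2)}.
Hypothesis g_x : forall x t, 0 <= x <= a -> 0 < t <= S ->
  deriv_within `[0, a] (g^~ t) x (gx x t).
Hypothesis gx_x : forall x t, 0 < x <= a -> 0 < t <= S ->
  deriv_within `[0, a] (gx^~ t) x (gxx x t).
Hypothesis g_t : forall x t, 0 <= x <= a -> 0 < t <= S ->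
  deriv_within `[0, S] (g x) t (gt x t).
Hypothesis gx_left : forall t, 0 < t <= S -> 0 < gx 0 t.
Hypothesis gx_right : forall t, 0 < t <= S -> 0 <= gx a t.
Hypothesis g_init : forall x y, 0 <= x <= y -> y <= a -> g x 0 <= g y 0.
(** The conclusion is strict because a minimum in time only yields [gt y t <= gt x t]. The case
    [y = a] is included, since the right point of a minimum may lie on the boundary; [x = 0] is left
    out, being excluded by [gx_left]. *)
Hypothesis g_crit : forall x y t, 0 < x < y -> y <= a -> 0 < t <= S ->
  gx x t = 0 -> gx y t = 0 -> gxx x t <= 0 -> 0 <= gxx y t ->
  gt x t < gt y t.

(* Doubling of variables uses no derivative of order three, contrary to a
   maximum principle applied to [g_x]. *)
Lemma nondecreasing_preserved x y t : 0 <= x <= y -> y <= a -> 0 <= t <= S ->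
  g x t <= g y t.
Proof.
pose K := [set z : R * R * R | [/\ 0 <= z.1.1 <= z.1.2,
  z.1.2 <= a & 0 <= z.2 <= S]].
pose D (z : R * R * R) := g z.1.2 z.2 - g z.1.1 z.2.
have c11 : continuous (fun z : R * R * R => z.1.1).
  by move=> z; apply: (@cvg_comp _ _ _ fst fst _ _ _ cvg_fst); exact: cvg_fst.
have c12 : continuous (fun z : R * R * R => z.1.2).
  by move=> z; apply: (@cvg_comp _ _ _ fst snd _ _ _ cvg_fst); exact: cvg_snd.
have c2 : continuous (fun z : R * R * R => z.2) by move=> z; exact: cvg_snd.
have K0 : K !=set0 by exists (0, 0, 0); rewrite /K/= lexx (ltW a_gt0).
have Kc : compact K.
  apply: (@subclosed_compact _ _ ((`[0, a] `*` `[0, a]) `*` `[0, S])).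
  - pose f (z : R * R * R) := z.1.2 - z.1.1.
    have -> : K = ((`[0, a] `*` `[0, a]) `*` `[0,
      S]) `&` (f @^-1` [set r | 0 <= r]).
      rewrite /f; apply/seteqP; split => -[[x1 y1] t1] /=;
        rewrite !in_itv/= subr_ge0.
        by move=> [/andP[x0 xy] ya ->]; rewrite x0 ya xy (le_trans xy ya)
          (le_trans x0 xy).
      by move=> [[[/andP[x0 _] /andP[_ ya]] tS] xy]; split=> //=; rewrite x0.
    apply: closedI.
      apply: compact_closed; first exact: norm_hausdorff.
      by apply: compact_setX; [apply: compact_setX|]; exact: segment_compact.
    apply: closed_comp; last exact: closed_ge.
    by move=> z _; apply: cvgB; [exact: c12|exact: c11].
  - by apply: compact_setX; [apply: compact_setX|]; exact: segment_compact.
  - move=> -[[x1 y1] t1] [/= /andP[x0 xy] ya t1S]; rewrite !in_itv/= x0 ya t1S.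
    by rewrite (le_trans xy ya) (le_trans x0 xy).
have Dc : {within K, continuous D}.
  apply: within_continuousB.
    apply: (@within_continuous_precomp _ _ _ K _ (fun z =>
      (z.1.2, z.2)) _ _ _ g_cont).
      exact: continuous_pair.
    by move=> -[[x1 y1] t1] [/= /andP[x0 xy] ya t1S];
      rewrite !in_itv/= ya t1S (le_trans x0).
  apply: (@within_continuous_precomp _ _ _ K _ (fun z =>
    (z.1.1, z.2)) _ _ _ g_cont).
    exact: continuous_pair.
  by move=> -[[x1 y1] t1] [/= /andP[x0 xy] ya t1S];
    rewrite !in_itv/= x0 t1S (le_trans xy).
have [[[x1 y1] t1]] := compact_EVT_min K0 Kc Dc.
rewrite inE => -[/= /andP[x10 xy1] ya1 /andP[t10 t1S]] Dmin xy ya tS.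
rewrite -subr_ge0; apply: (@le_trans _ _ (D (x1, y1, t1))); last first.
  by apply: (Dmin (x, y, t)); rewrite inE.
rewrite /D/= leNgt; apply/negP => Dneg.
have {}Dmin x2 y2 t2 : 0 <= x2 <= y2 -> y2 <= a -> 0 <= t2 <= S ->
    g y1 t1 - g x1 t1 <= g y2 t2 - g x2 t2.
  by move=> *; apply: (Dmin (x2, y2, t2)); rewrite inE.
(* [D] vanishes on the diagonal and is nonnegative at time 0, so a negative minimum has [x1 < y1]
   and [t1 > 0]. *)
have {xy1} xy1 : x1 < y1.
  by rewrite lt_neqAle xy1 andbT; apply: contraTneq Dneg => ->;
    rewrite subrr ltxx.
have {t10} t10 : 0 < t1.
  rewrite lt_neqAle t10 andbT; apply: contraTneq Dneg => <-;
    rewrite -leNgt subr_ge0.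
  by rewrite g_init// x10 ltW.
have t1S' : 0 < t1 <= S by rewrite t10.
have xa : x1 < a by exact: lt_le_trans ya1.
have y10 : 0 < y1 by exact: le_lt_trans xy1.
have sub c d : 0 <= c -> d <= a -> `[c, d] `<=` `[0, a].
  move=> c0 da z; rewrite /= !in_itv/= => /andP[cz zd].
  by rewrite (le_trans c0 cz) (le_trans zd da).
have ymin z : x1 <= z <= a -> g y1 t1 <= g z t1.
  move=> /andP[xz za]; have := @Dmin x1 z t1;
    rewrite x10 xz (ltW t10) => /(_ erefl za t1S).
  by rewrite lerD2r.
have xmax z : 0 <= z <= y1 -> g z t1 <= g x1 t1.
  move=> /andP[z0 zy]; have := @Dmin z y1 t1;
    rewrite z0 zy (ltW t10) => /(_ erefl ya1 t1S).
  by rewrite lerD2l lerN2.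
have dy : deriv_within `[0, a] (g^~ t1) y1 (gx y1 t1) by apply: g_x;
  rewrite // (ltW y10).
have dx : deriv_within `[0, a] (fun z => - g z t1) x1 (- gx x1 t1).
  by apply: deriv_withinN; apply: g_x; rewrite // x10 ltW.
(* With [x1] frozen, [y1] minimises [g] over [[x1, a]]. At [y1 = a] minimality only gives [gx <= 0],
   and [gx_right] provides the other sign. *)
have gy0 : gx y1 t1 = 0.
  apply/eqP; rewrite eq_le; apply/andP; split.
    apply: (deriv_within_min_left xy1 (sub _ _ x10 ya1) _ dy) => z /andP[xz zy].
    by apply: ymin; rewrite xz (le_trans zy).
  have [->|y1a] := eqVneq y1 a; first exact: gx_right.
  have {}ya1 : y1 < a by rewrite lt_neqAle y1a.
  apply: (deriv_within_min_right ya1 (sub _ _ (ltW y10) (lexx _)) _ dy) =>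
    z /andP[yz za].
  by apply: ymin; rewrite za (le_trans _ yz)// ltW.
(* With [y1] frozen, [x1] maximises [g] over [[0, y1]]. The side towards [y1] gives this sign, which
   [gx_left] forbids at 0; the point is therefore interior and the other side can be used as
   well. *)
have gx_le0 : gx x1 t1 <= 0.
  rewrite -oppr_ge0; apply: (deriv_within_min_right xy1 (sub _ _ x10 ya1) _ dx)
    => z.
  by move=> /andP[xz zy]; rewrite lerN2 xmax// zy (le_trans x10).
have {x10} x10 : 0 < x1.
  rewrite lt_neqAle x10 andbT; apply: contraTneq gx_le0 => <-.
  by rewrite -ltNge gx_left.
have subx : `[0, x1] `<=` `[0, a] by apply: sub => //; exact: ltW.
have gx0 : gx x1 t1 = 0.
  apply/eqP; rewrite eq_le gx_le0 -oppr_le0.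
  apply: (deriv_within_min_left x10 subx _ dx) => z /andP[z0 zx].
  by rewrite lerN2 xmax// z0 (le_trans zx)// ltW.
have gyy : 0 <= gxx y1 t1.
  apply: (@deriv_within_min_second _ `[0, a] (g^~ t1) (gx^~ t1) x1 y1) => //.
  - by apply: sub => //; exact: ltW.
  - move=> z /andP[xz zy]; apply: g_x => //.
    by rewrite (le_trans (ltW x10) xz) (le_trans zy).
  - by move=> z /andP[xz zy]; rewrite ymin// xz (le_trans zy).
  - by apply: gx_x => //; rewrite y10.
have gxx_le0 : gxx x1 t1 <= 0.
  rewrite -oppr_ge0.
  apply: (@deriv_within_min_second _ `[0, a] (fun z => - g z t1) (fun z =>
    - gx z t1) 0 x1) => //.
  - move=> z /andP[z0 zx]; apply: deriv_withinN; apply: g_x => //.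
    by rewrite z0 (le_trans zx)// ltW.
  - by move=> z /andP[z0 zx]; rewrite lerN2 xmax// z0 (le_trans zx)// ltW.
  - by rewrite gx0 oppr0.
  - by apply: deriv_withinN; apply: gx_x => //; rewrite x10 ltW.
(* Only earlier times are compared, as [t1] may be the final time [S]. *)
have : gt y1 t1 - gt x1 t1 <= 0.
  apply: (@deriv_within_min_left _ `[0, S] (fun s => g y1 s - g x1 s) 0 t1) =>
    //.
  - move=> z; rewrite /= !in_itv/= => /andP[-> zt]; exact: le_trans zt t1S.
  - move=> s /andP[s0 st]; apply: Dmin => //; rewrite ?(ltW x10) ?(ltW xy1)//.
    by rewrite s0 (le_trans st).
  - apply: deriv_withinD; first by apply: g_t => //; rewrite ya1 ltW.
    by apply: deriv_withinN; apply: g_t => //; rewrite !ltW.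
rewrite subr_le0 leNgt => /negP; apply.
by apply: g_crit => //; rewrite x10.
Qed.

End MonotonicityPreservation.

(** * Comparison principle for the heat equation with Robin conditions *)

Section RobinComparison.
Context {R : realType}.
Implicit Types (x y s t : R).
Variables (a S L : R) (w wx wxx wt : R -> R -> R).
Hypothesis a_gt0 : 0 < a.
Hypothesis S_ge0 : 0 <= S.
Hypothesis L_ge0 : 0 <= L.
Hypothesis w_cont :
  {within `[0, a] `*` `[0, S], continuous (fun z : R * R => w z.1 z.2)}.
Hypothesis w_x : forall x t, 0 <= x <= a -> 0 < t <= S ->
  deriv_within `[0, a] (w^~ t) x (wx x t).
Hypothesis wx_x : forall x t, 0 < x < a -> 0 < t <= S ->
  deriv_within `[0, a] (wx^~ t) x (wxx x t).
Hypothesis w_t : forall x t, 0 <= x <= a -> 0 < t <= S ->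
  deriv_within `[0, S] (w x) t (wt x t).
Hypothesis w_super : forall x t, 0 < x < a -> 0 < t <= S -> wxx x t <= wt x t.
Hypothesis w_left : forall t, 0 < t <= S -> w 0 t < 0 -> wx 0 t <= - L * w 0 t.
Hypothesis w_right : forall t, 0 < t <= S -> w a t < 0 -> L * w a t <= wx a t.
Hypothesis w_init : forall x, 0 <= x <= a -> 0 <= w x 0.

(* The weight [exp (M (x - a / 2) ^ 2 + K t)] turns the Robin conditions, whose
   sign is the wrong one for the maximum principle, into strict inequalities. *)
Lemma robin_comparison x t : 0 <= x <= a -> 0 <= t <= S -> 0 <= w x t.
Proof.
have a0 := a_gt0.
(* The logarithmic [x]-derivative of the weight is [- M * a] at 0 and [M * a] at [a]; this choice
   makes its size [L + 1], one more than the Robin constant. *)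
pose M := (L + 1) / a.
have Ma : M * a = L + 1 by rewrite divfK// gt_eqF.
have M0 : 0 < M by rewrite divr_gt0// ltr_wpDl.
(* On [[0, a]] the quotient [Fxx / F] is at most [2 * M + (M * a) ^+ 2], so [K] exceeds it by at
   least 1. *)
pose K := 2 * M + (L + 1) ^+ 2 + 1.
pose e (x t : R) : R := M * (x - a / 2) ^+ 2 + K * t.
pose F (x t : R) : R := expR (e x t).
pose Fx (x t : R) : R := 2 * M * (x - a / 2) * F x t.
pose Fxx (x t : R) : R := (2 * M + (2 * M * (x - a / 2)) ^+ 2) * F x t.
have F_x (y s : R) : is_derive y 1 (F^~ s) (Fx y s).
  have h : is_derive y 1 (e^~ s) (2 * M * (y - a / 2)).
    by apply: is_derive_eq; rewrite /GRing.scale/=; field.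
  have := @is_derive1_comp _ expR (e^~ s) y _ _ (is_derive_expR _) h.
  by rewrite mulrC.
have F_xx (y s : R) : is_derive y 1 (Fx^~ s) (Fxx y s).
  have h := F_x y s.
  by apply: is_derive_eq; rewrite /GRing.scale/= /Fxx /Fx; field.
have F_t (y s : R) : is_derive s 1 (F y) (K * F y s).
  have h : is_derive s 1 (e y) K.
    by apply: is_derive_eq; rewrite /GRing.scale/=; field.
  have := @is_derive1_comp _ expR (e y) s _ _ (is_derive_expR _) h.
  by rewrite mulrC.
have F0 (y s : R) : 0 < F y s by exact: expR_gt0.
have Fc : continuous (fun z : R * R => F z.1 z.2).
  move=> z.
  apply: (@cvg_comp _ _ _ (fun z : R * R => e z.1 z.2) expR _ (nbhs (e z.1
    z.2))); last exact: continuous_expR.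
  apply: cvgD; apply: cvgM; [exact: cvg_cst| |exact: cvg_cst|exact: cvg_snd].
  by apply: cvgM; apply: cvgB; [exact: cvg_fst|exact: cvg_cst|exact:
    cvg_fst|exact: cvg_cst].
clearbody F.
pose Q := `[0, a]%classic `*` `[0, S]%classic.
have Qc : compact Q by apply: compact_setX; exact: segment_compact.
have Q0 : Q !=set0 by exists (0, 0); rewrite /Q/= !in_itv/= lexx (ltW a_gt0).
pose E (z : R * R) := w z.1 z.2 / F z.1 z.2.
have Ec : {within Q, continuous E}.
  move=> z; apply: cvgM; first exact: w_cont.
  apply: cvgV; first by rewrite gt_eqF.
  by move: z; apply: continuous_subspaceT.
have [[x1 t1]] := compact_EVT_min Q0 Qc Ec.
rewrite inE => -[/=]; rewrite !in_itv/= => x1a t1S Emin xa tS.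
have {}Emin (y s : R) : 0 <= y <= a -> 0 <= s <= S ->
  w x1 t1 / F x1 t1 <= w y s / F y s.
  by move=> *; apply: (Emin (y, s)); rewrite inE; split; rewrite /= in_itv.
have : 0 <= w x t / F x t.
  apply: le_trans (Emin x t xa tS).
  rewrite leNgt; apply/negP => Eneg.
  pose m := - (w x1 t1 / F x1 t1).
  have m0 : 0 < m by rewrite oppr_gt0.
  have w1 : w x1 t1 = - (m * F x1 t1) by rewrite /m mulNr opprK divfK// gt_eqF.
  have mF0 : 0 < m * F x1 t1 by rewrite mulr_gt0.
  have w1neg : w x1 t1 < 0 by rewrite w1 oppr_lt0.
  (* Since [- m] is the minimum of [w / F], the function [Z] is nonnegative and vanishes at
     [(x1, t1)]. The minimum tests apply to it. *)
  pose Z (y s : R) : R := w y s + m * F y s.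
  have Z1 : Z x1 t1 = 0 by rewrite /Z w1 addNr.
  have Zmin (y s : R) : 0 <= y <= a -> 0 <= s <= S -> Z x1 t1 <= Z y s.
    move=> ya sS; rewrite Z1 /Z -lerBlDr sub0r -mulNr opprK -ler_pdivlMr//.
    exact: Emin.
  have t10 : 0 < t1.
    move: t1S => /andP[]; rewrite le_eqVlt => /predU1P[t10|//] _.
    by move: w1neg; rewrite -t10 ltNge w_init.
  have t1S' : 0 < t1 <= S by move: t1S => /andP[_ ->]; rewrite t10.
  have dF (y s m' : R) : is_derive y 1 (F^~ s) m' ->
    deriv_within `[0, a] (fun z => m * F z s) y (m * m').
    by move=> h; apply: is_derive_deriv_within.
  have Z_x (y : R) : 0 <= y <= a -> deriv_within `[0,
    a] (Z^~ t1) y (wx y t1 + m * Fx y t1).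
    by move=> ya; apply: deriv_withinD; [exact: w_x|exact: dF (F_x _ _)].
  have x10 : 0 < x1.
    move: x1a => /andP[]; rewrite le_eqVlt => /predU1P[x10|//] _; exfalso.
    (* At the left end [wx <= L * (m * F)] while [m * Fx = - (L + 1) * (m * F)], so the sum is at
       most [- (m * F) < 0]. The right end is symmetric. *)
    have : 0 <= wx x1 t1 + m * Fx x1 t1.
      apply: (@deriv_within_min_right _ `[0, a] (Z^~ t1) x1 a) => //.
      + by rewrite -x10.
      + by rewrite -x10.
      + by move=> y; rewrite -{1}x10 => ya; exact: Zmin.
      + by apply: Z_x; rewrite -x10 lexx ltW.
    have x1E : x1 = 0 by [].
    have wl : w x1 t1 < 0 -> wx x1 t1 <= - L * w x1 t1.
      by rewrite x1E; exact: w_left.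
    have := wl w1neg; rewrite w1 /Fx.
    have -> : m * (2 * M * (x1 - a / 2) * F x1 t1) =
        (2 * M * x1 - M * a) * (m * F x1 t1) by field.
    by rewrite Ma x1E mulr0 sub0r -x1E; lra.
  have x1a' : x1 < a.
    rewrite lt_neqAle; move: (x1a) => /andP[_ ->]; rewrite andbT.
    apply/eqP => x1E.
    have : wx x1 t1 + m * Fx x1 t1 <= 0.
      apply: (@deriv_within_min_left _ `[0, a] (Z^~ t1) 0 x1) => //.
      + by rewrite x1E.
      + by move=> y; rewrite {1}x1E => ya; exact: Zmin.
      + exact: Z_x.
    have := w_right t1S'; rewrite -x1E => /(_ w1neg).
    rewrite w1 /Fx.
    have -> : m * (2 * M * (x1 - a / 2) * F x1 t1) =
        (2 * M * x1 - M * a) * (m * F x1 t1) by field.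
    by rewrite -mulrA x1E Ma -x1E; lra.
  have sub0x : `[0, x1] `<=` `[0, a].
    move=> y; rewrite /= !in_itv/= => /andP[-> yx]; exact: le_trans (ltW x1a').
  have minl y : 0 <= y <= x1 -> Z x1 t1 <= Z y t1.
    by move=> /andP[y0 yx]; apply: Zmin => //; rewrite y0 (le_trans yx) ?ltW.
  have Zx0 : wx x1 t1 + m * Fx x1 t1 = 0.
    apply/eqP; rewrite eq_le; apply/andP; split.
      by apply: (deriv_within_min_left x10 sub0x minl); exact: Z_x.
    apply: (@deriv_within_min_right _ `[0, a] (Z^~ t1) x1 a) => //.
    + move=> y; rewrite /= !in_itv/= => /andP[xy ->]; rewrite andbT.
      exact: le_trans (ltW x10) xy.
    + move=> y /andP[xy ya]; apply: Zmin => //; rewrite ya andbT.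
      by rewrite (le_trans _ xy) ?ltW.
    + exact: Z_x.
  have Zxx : 0 <= wxx x1 t1 + m * Fxx x1 t1.
    apply: (@deriv_within_min_second _ `[0, a] (Z^~ t1)
      (fun y => wx y t1 + m * Fx y t1) 0 x1) => //.
    + by move=> y yx; apply: Z_x; have := sub0x y; rewrite /= !in_itv/=; apply.
    + apply: deriv_withinD; first by apply: wx_x; rewrite ?x10.
      by have h := F_xx x1 t1; apply: is_derive_deriv_within.
  have Zt : wt x1 t1 + m * (K * F x1 t1) <= 0.
    apply: (@deriv_within_min_left _ `[0, S] (Z x1) 0 t1) => //.
    + move=> y; rewrite /= !in_itv/= => /andP[-> yt].
      by move: t1S => /andP[_]; exact: le_trans yt.
    + move=> y /andP[y0 yt]; apply: Zmin => //; rewrite y0.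
      by move: t1S => /andP[_]; exact: le_trans yt.
    + apply: deriv_withinD; first exact: w_t.
      by have h := F_t x1 t1; apply: is_derive_deriv_within.
  have x1aa : 0 < x1 < a by rewrite x10.
  have := w_super x1aa t1S'.
  (* The tests give [- m * Fxx <= wxx <= wt <= - m * K * F] at the minimum, which is incompatible
     with [K * F > Fxx]. *)
  have : 0 < (K - (2 * M + (2 * M * (x1 - a / 2)) ^+ 2)) * (m * F x1 t1).
    apply: mulr_gt0 => //.
    have -> : K - (2 * M + (2 * M * (x1 - a / 2)) ^+ 2) =
        1 + (L + 1) ^+ 2 - (M * a) ^+ 2 + 4 * (M ^+ 2 * (x1 * (a - x1))).
      by rewrite /K; field.
    rewrite Ma addrK ltr_pwDl// mulr_ge0// mulr_ge0 ?sqr_ge0//.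
    by rewrite mulr_ge0 ?subr_ge0 ?ltW.
  move: Zxx Zt; rewrite /Fxx.
  set A := 2 * M + _; rewrite !(mulrCA m) mulrBl; lra.
by rewrite pmulr_lge0 ?invr_gt0.
Qed.

End RobinComparison.

(** * The heat equation up to the right end, and monotonicity of the solution in space *)

Section Solution.
Context {R : realType}.
Variables (a p q T : R) (u0 : R -> R) (u : R -> R -> R).
Hypothesis a_gt0 : 0 < a.
Hypothesis q_gt0 : 0 < q.
Hypothesis u_sol : classical_solution a p q u0 T u.

Implicit Types (x y z w s t d S : R).

Lemma sol_x x t : 0 <= x <= a -> 0 <= t < T ->
  deriv_within `[0, a] (u^~ t) x (d_x a u x t).
Proof. by move=> xa tT; apply: (sol_derivable_x u_sol tT);
  rewrite /= in_itv. Qed.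

Lemma sol_xx x t : 0 <= x <= a -> 0 < t < T ->
  deriv_within `[0, a] ((d_x a u)^~ t) x (d_xx a u x t).
Proof. by move=> xa tT; apply: (sol_derivable_xx u_sol tT);
  rewrite /= in_itv. Qed.

Lemma sol_t x t : 0 <= x <= a -> 0 < t < T -> is_derive t 1 (u x) (d_t u x t).
Proof.
by move=> xa tT; split; [exact: (sol_derivable_t u_sol)|rewrite /d_t derive1E].
Qed.

(** Both sides are continuous in [x] up to [a] for fixed [t > 0], so the interior equation passes to
    the limit. It is what allows the doubling argument to have its right point at [a]. *)
Lemma sol_heat_right t : 0 < t < T -> d_t u a t = d_xx a u a t.
Proof.
move=> tT; pose f x := d_t u x t - d_xx a u x t.
have fc : {within `[0, a], continuous f}.
  have h B (F : R -> R -> R) : B = `[0, a] `*` `]0, T[ ->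
      {within B, continuous (fun z : R * R => F z.1 z.2)} ->
      {within `[0, a], continuous (F^~ t)}.
    move=> -> cF.
    apply: (@within_continuous_precomp _ _ _ `[0, a] _ (fun x =>
      (x, t)) _ _ _ cF).
      by apply: continuous_pair => x; [exact: cvg_id|exact: cvg_cst].
    by move=> x xa; split=> //=; rewrite in_itv.
  apply: within_continuousB.
    by apply: h erefl _; exact: (sol_cont_t u_sol).
  by apply: h erefl _; exact: (sol_cont_xx u_sol).
apply/eqP; rewrite -subr_eq0 -/(f a); apply: contraT; rewrite -normr_gt0 => fa.
have aa : `[0, a]%classic a by rewrite /= in_itv/= lexx ltW.
have /subspace_continuousP/(_ _ aa)/cvgrPdist_lt/(_ _ fa)/nbhs_ballP := fc.
move=> [d /= d0 hd]; pose x := Num.max (a / 2) (a - d / 2).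
have a0 := a_gt0.
have xa : x < a.
  have a2 : a / 2 < a by lra.
  have d2 : a - d / 2 < a by lra.
  by rewrite gt_max a2.
have x0 : a / 2 <= x by rewrite le_max lexx.
have dx : a - d / 2 <= x by rewrite le_max lexx orbT.
have f0 : f x = 0 by rewrite /f (sol_heat u_sol)// ?subrr//; apply/andP; split;
  lra.
have : `|f a - f x| < `|f a|.
  apply: hd; first by rewrite /ball/= ltr_norml; apply/andP; split; lra.
  by rewrite /= in_itv/=; apply/andP; split; lra.
by rewrite f0 subr0 ltxx.
Qed.

Lemma sol_heat_closed x t : 0 < x <= a -> 0 < t < T -> d_t u x t = d_xx a u x t.
Proof.
move=> /andP[x0 xa] tT; have [->|xna] := eqVneq x a;
  first exact: sol_heat_right.
by apply: (sol_heat u_sol) => //; rewrite x0 lt_neqAle xna.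
Qed.

Lemma sol_cont_segment S : S < T ->
  {within `[0, a] `*` `[0, S], continuous (fun z : R * R => u z.1 z.2)}.
Proof.
move=> ST; apply: continuous_subspaceW (sol_cont u_sol) => -[x t] /=.
by rewrite !in_itv/= => -[-> /andP[-> tS]]; split=> //; exact: le_lt_trans ST.
Qed.

Hypothesis u_x_ge : forall x, 0 < x < a ->
  x / a * (1 - u x 0) `^ (- q) <= d_x a u x 0.

Lemma sol_initial_nondecreasing x y : 0 < T -> 0 <= x <= y -> y <= a ->
  u x 0 <= u y 0.
Proof.
move=> T0 /andP[x0 xy] ya.
apply: (@deriv_within_nondecreasing _ `[0, a] (u^~ 0) ((d_x a u)^~ 0)) => //.
- move=> z; rewrite /= !in_itv/= => /andP[xz zy].
  by rewrite (le_trans x0 xz) (le_trans zy ya).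
- move=> z /andP[xz zy]; apply: sol_x; last by rewrite lexx.
  by rewrite (le_trans x0 xz) (le_trans zy ya).
- move=> z /andP[xz zy]; have z0 : 0 < z by exact: le_lt_trans xz.
  apply: le_trans (u_x_ge _); last by rewrite z0 (lt_le_trans zy).
  by rewrite mulr_ge0 ?powR_ge0// divr_ge0 ?ltW.
Qed.

Lemma sol_nondecreasing x y t : 0 <= x <= y -> y <= a -> 0 <= t < T ->
  u x t <= u y t.
Proof.
move=> /andP[x0 xy] ya /andP[t0 tT].
(* [b] is nonincreasing on [[0, a]], its derivative vanishes at [a], and its second derivative at
   [z] is [z]. Thus [g = u - d * b] keeps the required signs of [gx] at both ends, and
   [gt = gxx + d * x] supplies the strictness in [g_crit]. *)
pose b z : R := z ^+ 3 / 6 - a ^+ 2 / 2 * z.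
have bxy (z w : R) : 0 <= z <= w -> w <= a -> b w <= b z.
  move=> /andP[z0 zw] wa; rewrite -subr_ge0.
  have -> : b z - b w = (w - z) * (a ^+ 2 / 2 - (w ^+ 2 + w * z + z ^+ 2) / 6).
    by rewrite /b; field.
  apply: mulr_ge0; first by rewrite subr_ge0.
  by nra.
have b' (z : R) : is_derive z 1 b (z ^+ 2 / 2 - a ^+ 2 / 2).
  by apply: is_derive_eq; rewrite /GRing.scale/=; field.
have bc : continuous b.
  by move=> z; apply/differentiable_continuous/derivable1_diffP; case: (b' z).
have sT (s : R) : 0 < s <= t -> 0 < s < T by move=> /andP[-> st];
  exact: le_lt_trans tT.
have key (d : R) : 0 < d -> u x t - d * b x <= u y t - d * b y.
  move=> d0.
  apply: (@nondecreasing_preserved _ a t (fun x t => u x t - d * b x)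
    (fun x t => d_x a u x t - d * (x ^+ 2 / 2 - a ^+ 2 / 2))
    (fun x t => d_xx a u x t - d * x) (d_t u)) => //; rewrite ?x0 ?t0 ?lexx//.
  - apply: within_continuousB; first exact: sol_cont_segment.
    apply: continuous_subspaceT => z; apply: cvgM; first exact: cvg_cst.
    by apply: (@cvg_comp _ _ _ fst b _ _ _ cvg_fst); exact: bc.
  - move=> z s za /sT/andP[s0 sT']; apply: deriv_withinD.
      by apply: sol_x; rewrite ?(ltW s0).
    by apply: deriv_withinN; apply: is_derive_deriv_within.
  - move=> z s /andP[z0 za] /sT st; apply: deriv_withinD.
      by apply: sol_xx; rewrite ?(ltW z0).
    apply: deriv_withinN; apply: is_derive_deriv_within.
    by apply: is_derive_eq; rewrite /GRing.scale/=; field.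
  - move=> z s za /sT st.
    rewrite -[d_t u z s]addr0; apply: deriv_withinD.
      by apply: is_derive_deriv_within; apply: sol_t.
    apply: is_derive_deriv_within; exact: is_derive_cst.
  - move=> s /sT st; rewrite (sol_flux_left u_sol)//.
    have := @powR_gt0 _ (u 0 s) (- p) (sol_gt0_left u_sol st).
    have : 0 < d * (a ^+ 2 / 2) by rewrite mulr_gt0// divr_gt0// exprn_gt0.
    by rewrite expr0n/= mul0r sub0r mulrN opprK; lra.
  - move=> s /sT st; rewrite (sol_flux_right u_sol)// subrr mulr0 subr0.
    exact: powR_ge0.
  - move=> z w zw wa; apply: lerB.
      by apply: sol_initial_nondecreasing => //; exact: le_lt_trans tT.
    by rewrite ler_pM2l// bxy.
  - move=> z w s /andP[z0 zw] wa /sT st _ _ + +.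
    have w0 : 0 < w by exact: lt_trans zw.
    rewrite !sol_heat_closed ?w0 ?z0 ?(le_trans (ltW zw) wa)//.
    have : d * z < d * w by rewrite ltr_pM2l.
    lra.
rewrite leNgt; apply/negP => uyx.
have Bge : 0 <= b x - b y by rewrite subr_ge0 bxy ?x0.
(* Chosen small enough that [d * (b x - b y) < u x t - u y t], contradicting [key]. *)
pose d := (u x t - u y t) / (b x - b y + 1).
have B1 : 0 < b x - b y + 1 by lra.
have d0 : 0 < d by rewrite divr_gt0// subr_gt0.
have := key d d0.
have : d * (b x - b y + 1) = u x t - u y t by rewrite divfK// gt_eqF.
by lra.
Qed.

(** * The upper bound 1 and the monotonicity of the potential *)

Hypothesis u0_lt1 : u0 a < 1.

(** [classical_solution] keeps [u] below 1 only at [x = a]; monotonicity in [x] carries the bound to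
    the whole interval. *)
Lemma sol_lt1 x t : 0 <= x <= a -> 0 <= t < T -> u x t < 1.
Proof.
move=> /andP[x0 xa] tT.
apply: (@le_lt_trans _ _ (u a t)); first by rewrite sol_nondecreasing ?x0 ?lexx.
move: tT => /andP[]; rewrite le_eqVlt => /predU1P[<-|t0] tT.
  by rewrite (sol_initial u_sol)// lexx ltW.
by apply: (sol_lt1_right u_sol); rewrite t0.
Qed.

(* Its [x]-derivative is [(1 - u) `^ q] times the auxiliary function
   [u_x - (x / a) (1 - u) `^ (- q)]. *)
Definition potential x t : R :=
  - ((1 - u x t) `^ (q + 1) / (q + 1)) - x ^+ 2 / (2 * a).

Definition potential_x x t : R := (1 - u x t) `^ q * d_x a u x t - x / a.

Definition potential_xx x t : R :=
  - (q * (1 - u x t) `^ (q - 1)) * d_x a u x t * d_x a u x t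
  + (1 - u x t) `^ q * d_xx a u x t - a^-1.

Lemma is_derive_potential_profile s : s < 1 ->
  is_derive s 1 (fun z => - ((1 - z) `^ (q + 1) / (q + 1))) ((1 - s) `^ q).
Proof.
move=> s1; have q0 := q_gt0; have q1 : q + 1 != 0 by rewrite gt_eqF// addr_gt0.
have h := is_derive_powR_onem (q + 1) s1.
have -> : (fun z => - ((1 - z) `^ (q + 1) / (q + 1))) =
    (fun z => (- (q + 1)^-1) * (1 - z) `^ (q + 1)).
  by apply/funext => z; rewrite mulrC mulNr.
apply: is_derive_eq; rewrite /GRing.scale/= addrK; field.
by [].
Qed.

Lemma potential_deriv x t : 0 <= x <= a -> 0 <= t < T ->
  deriv_within `[0, a] (potential^~ t) x (potential_x x t).
Proof.
move=> xa tT; apply: deriv_withinD.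
  exact: deriv_within_comp (sol_x xa tT) (is_derive_potential_profile (sol_lt1
    xa tT)).
apply: deriv_withinN; apply: is_derive_deriv_within.
apply: is_derive_eq; rewrite /GRing.scale/=; field.
by rewrite gt_eqF.
Qed.

Lemma potential_x_deriv x t : 0 <= x <= a -> 0 < t < T ->
  deriv_within `[0, a] (potential_x^~ t) x (potential_xx x t).
Proof.
move=> xa tT; have tT' : 0 <= t < T by move: tT => /andP[/ltW -> ->].
apply: deriv_withinD.
  apply: deriv_withinM (sol_xx xa tT).
  have := deriv_within_comp (sol_x xa tT') (is_derive_powR_onem q (sol_lt1 xa
    tT')).
  by rewrite -mulNr.
apply: deriv_withinN; apply: is_derive_deriv_within.
by apply: is_derive_eq; rewrite /GRing.scale/= mulr0 add0r mulr1.
Qed.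

Lemma potential_heat x t : 0 < x <= a -> 0 < t < T -> potential_x x t = 0 ->
  (1 - u x t) `^ q * d_t u x t =
  potential_xx x t + a^-1 + q * (x / a) ^+ 2 * (1 - u x t) `^ (- (q + 1)).
Proof.
move=> /andP[x0 xa] tT /eqP; rewrite subr_eq0 => /eqP gx0.
rewrite sol_heat_closed ?x0// /potential_xx -gx0.
have W0 : 1 - u x t != 0.
  by rewrite gt_eqF// subr_gt0 sol_lt1 ?(ltW x0)//;
    move: tT => /andP[/ltW -> ->].
have -> : (1 - u x t) `^ (q - 1) = (1 - u x t) `^ q * (1 - u x t) `^ q * (1 - u
  x t) `^ (- (q + 1)).
  by rewrite -!powRD ?W0 ?implybT//; congr (_ `^ _); ring.
ring.
Qed.

Lemma potential_x_right t : 0 < t < T -> potential_x a t = 0.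
Proof.
move=> tT; have W0 : 0 < (1 - u a t) `^ q.
  by rewrite powR_gt0// subr_gt0; exact: (sol_lt1_right u_sol).
by rewrite /potential_x (sol_flux_right u_sol)// powRN !divff ?subrr ?gt_eqF.
Qed.

Lemma potential_nondecreasing x y t : 0 <= x <= y -> y <= a -> 0 <= t < T ->
  potential x t <= potential y t.
Proof.
move=> xy ya /andP[t0 tT].
have sT (s : R) : 0 <= s <= t -> 0 <= s < T by move=> /andP[-> st];
  exact: le_lt_trans tT.
have sT' (s : R) : 0 < s <= t -> 0 < s < T by move=> /andP[-> st];
  exact: le_lt_trans tT.
apply: (@nondecreasing_preserved _ a t potential potential_x potential_xx
  (fun x t => (1 - u x t) `^ q * d_t u x t)) => //; rewrite ?t0 ?lexx//.
- apply: within_continuousB.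
    apply: (@within_continuous_comp _ _ _ _ (fun z : R * R => u z.1 z.2)
      (fun s => - ((1 - s) `^ (q + 1) / (q + 1))));
        last exact: sol_cont_segment.
    move=> s; rewrite inE => -[[z r] [/=]]; rewrite !in_itv/= => za rt <-.
    apply/differentiable_continuous/derivable1_diffP.
    by case: (is_derive_potential_profile (sol_lt1 za (sT _ rt))).
  apply: continuous_subspaceT => z; apply: cvgM; last exact: cvg_cst.
  by apply: cvgM; exact: cvg_fst.
- by move=> z s za /sT' /andP[s0 st]; apply: potential_deriv; rewrite ?(ltW s0).
- by move=> z s /andP[z0 za] /sT' st; apply: potential_x_deriv;
  rewrite ?(ltW z0).
- move=> z s za /sT' st; rewrite -[X in deriv_within _ _ _ X]addr0.
  apply: deriv_withinD; last by apply: is_derive_deriv_within;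
    exact: is_derive_cst.
  have st' : 0 <= s < T by move: st => /andP[/ltW -> ->].
  apply: is_derive_deriv_within.
  exact: (@is_derive1_comp _ _ _ _ _ _ (is_derive_potential_profile (sol_lt1 za
    st')) (sol_t za st)).
- move=> s /sT' st; rewrite /potential_x mul0r subr0 (sol_flux_left u_sol)//.
  have st' : 0 <= s < T by move: st => /andP[/ltW -> ->].
  rewrite mulr_gt0// powR_gt0//; last exact: (sol_gt0_left u_sol).
  by rewrite subr_gt0 sol_lt1// lexx ltW.
- by move=> s /sT' st; rewrite potential_x_right.
- move=> z w /andP[z0 zw] wa.
  have T0 : 0 <= (0 : R) < T by rewrite lexx (le_lt_trans t0).
  apply: (@deriv_within_nondecreasing _ `[0,
    a] (potential^~ 0) (potential_x^~ 0)) => //.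
  + move=> r; rewrite /= !in_itv/= => /andP[zr rw].
    by rewrite (le_trans z0 zr) (le_trans rw wa).
  + move=> r /andP[zr rw]; apply: potential_deriv => //.
    by rewrite (le_trans z0 zr) (le_trans rw wa).
  + move=> r /andP[zr rw]; have r0 : 0 < r by exact: le_lt_trans zr.
    have ra : r < a by exact: lt_le_trans wa.
    have W0 : 0 < 1 - u r 0 by rewrite subr_gt0 sol_lt1// (ltW r0) (ltW ra).
    rewrite subr_ge0 [leRHS]mulrC -ler_pdivrMr ?powR_gt0// -powRN.
    by apply: u_x_ge; rewrite r0.
- move=> z w s /andP[z0 zw] wa /sT' st gz gw gzz gww.
  have st' : 0 <= s < T by move: st => /andP[/ltW -> ->].
  have w0 : 0 < w by exact: lt_trans zw.
  have za : z <= a by rewrite (le_trans (ltW zw)).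
  rewrite !potential_heat ?w0 ?z0//.
  have q0 := q_gt0.
  have Wz : 0 < 1 - u z s by rewrite subr_gt0 sol_lt1// (ltW z0).
  have Ww : 0 < 1 - u w s by rewrite subr_gt0 sol_lt1// (ltW w0).
  have Wwz : 1 - u w s <= 1 - u z s by rewrite lerB// sol_nondecreasing// (ltW
    z0) (ltW zw).
  have E : (1 - u z s) `^ (- (q + 1)) <= (1 - u w s) `^ (- (q + 1)).
    rewrite !powRN lef_pV2 ?posrE ?powR_gt0//.
    have q1 : 0 <= q + 1 by lra.
    by apply: ge0_ler_powR; rewrite // nnegrE ltW.
  apply: ler_ltD; first by rewrite lerD2r (le_trans gzz).
  rewrite -[ltLHS]mulrA -[ltRHS]mulrA ltr_pM2l//.
  apply: (@lt_le_trans _ _ ((w / a) ^+ 2 * (1 - u z s) `^ (- (q + 1)))).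
    have zwa : z / a < w / a by rewrite ltr_pM2r// invr_gt0.
    have za0 : 0 <= z / a by rewrite divr_ge0 ?ltW.
    rewrite ltr_pM2r ?powR_gt0// ltr_pXn2r// nnegrE//.
    exact: le_trans (ltW zwa).
  by rewrite ler_wpM2l// sqr_ge0.
Qed.

End Solution.

(** * The solution stays above its initial value *)

Section InitialComparison.
Context {R : realType}.
Implicit Types (x y s t r : R).

Variables (a p q T : R) (u0 : R -> R) (u : R -> R -> R).
Hypotheses (a_gt0 : 0 < a) (p_gt0 : 0 < p) (q_gt0 : 0 < q) (T_gt0 : 0 < T).
Hypothesis u0_adm : admissible_initial a p q u0.
Hypothesis u_sol : classical_solution a p q u0 T u.

Let u0E x : `[0, a]%classic x -> u x 0 = u0 x.
Proof. by rewrite /= in_itv/=; exact: (sol_initial u_sol). Qed.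

Lemma sol_x_initial x : `[0, a]%classic x ->
  d_x a u x 0 = derive_on `[0, a] u0 x.
Proof. exact: derive_on_ext u0E. Qed.

(** [classical_solution] gives the second derivative only for [t > 0]; at time 0 it comes from the
    smoothness of [u0]. *)
Lemma sol_xx_initial x : 0 <= x <= a ->
  deriv_within `[0, a] ((d_x a u)^~ 0) x (d_xx a u x 0).
Proof.
move=> xa; have Ax : `[0, a]%classic x by rewrite /= in_itv.
rewrite /d_xx (derive_on_ext sol_x_initial Ax).
have := derivable_deriv_within (@initial_smooth _ _ _ _ _ u0_adm 1) Ax.
by apply: deriv_within_ext => // y /sol_x_initial.
Qed.

Hypothesis u_xx_ge0 : forall x, 0 < x < a -> 0 <= d_xx a u x 0.

(** The difference [w] between [u] and its initial value satisfies [w_t - w_xx = d_xx a u x 0 >= 0].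
    The compatibility conditions express the initial slopes as fluxes, and linearising the flux
    differences gives Robin inequalities for [w]. *)
Lemma sol_ge_initial x t : 0 <= x <= a -> 0 <= t < T -> u x 0 <= u x t.
Proof.
move=> xa /andP[t0 tT]; rewrite -subr_ge0.
have sT s : 0 < s <= t -> 0 < s < T by move=> /andP[-> st];
  exact: le_lt_trans tT.
have A0 : `[0, a]%classic 0 by rewrite /= in_itv/= lexx ltW.
have Aa : `[0, a]%classic a by rewrite /= in_itv/= lexx ltW.
have u_cont := sol_cont_segment u_sol tT.
(* The minimum of [u 0] over [[0, t]] is attained, hence positive; it keeps the left flux away from
   its singularity. *)
have [s0 s0t u0min] : exists2 s, s \in `[0, t] & forall r, r \in `[0, t] ->
  u 0 s <= u 0 r.
  apply: EVT_min => //.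
  apply: (@within_continuous_precomp _ _ _ `[0, t] _ (fun s =>
    (0, s)) _ _ _ u_cont).
    by apply: continuous_pair => s; [exact: cvg_cst|exact: cvg_id].
  by move=> s st; split.
pose c := u 0 s0.
have c0 : 0 < c.
  rewrite /c; move: s0t; rewrite in_itv/= => /andP[];
    rewrite le_eqVlt => /predU1P[<- _|s00 s0t].
    by rewrite u0E//; exact: initial_gt0_left u0_adm.
  by apply: (sol_gt0_left u_sol); apply: sT; rewrite s00.
(* [L1] and [L2] are the Lipschitz constants of the left and right fluxes; their sum serves at both
   ends. *)
pose L1 := p * c `^ (- (p + 1)).
pose L2 := q * (1 - u a 0) `^ (- (q + 1)).
have ua1 : u a 0 < 1 by rewrite u0E//; exact: initial_lt1_right u0_adm.
have L10 : 0 <= L1 by rewrite mulr_ge0 ?powR_ge0 ?ltW.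
have L20 : 0 <= L2 by rewrite mulr_ge0 ?powR_ge0 ?ltW.
apply: (@robin_comparison _ a t (L1 + L2) (fun x t => u x t - u x 0)
  (fun x t => d_x a u x t - d_x a u x 0) (fun x t =>
    d_xx a u x t - d_xx a u x 0)
  (d_t u)) => //; rewrite ?t0 ?lexx ?addr_ge0//.
- apply: within_continuousB => //.
  apply: (@within_continuous_precomp _ _ _ _ _ (fun z : R * R =>
    (z.1, 0)) _ _ _ u_cont).
    by apply: continuous_pair => z; [exact: cvg_fst|exact: cvg_cst].
  by move=> z [za _]; split=> //=; rewrite in_itv/= lexx t0.
- move=> y s ya /sT/andP[s1 sT']; apply: deriv_withinD.
    by apply: (sol_x u_sol); rewrite ?(ltW s1).
  by apply: deriv_withinN; apply: (sol_x u_sol) => //; rewrite lexx.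
- move=> y s /andP[y0 ya] /sT sT'; apply: deriv_withinD.
    by apply: (sol_xx u_sol); rewrite ?(ltW y0) ?ltW.
  by apply: deriv_withinN; apply: sol_xx_initial; rewrite !ltW.
- move=> y s ya /sT sT'; rewrite -[d_t u y s]addr0; apply: deriv_withinD.
    by apply: is_derive_deriv_within; apply: (sol_t u_sol).
  by apply: is_derive_deriv_within; exact: is_derive_cst.
- move=> y s ya /sT sT'; rewrite (sol_heat u_sol)// gerBl.
  exact: u_xx_ge0.
- move=> s st; have /sT sT' := st; rewrite subr_lt0 => us.
  rewrite (sol_flux_left u_sol)// (sol_x_initial A0) (compat_left u0_adm)
    -u0E//.
  have cs : c <= u 0 s <= u 0 0.
    rewrite (ltW us) andbT; apply: u0min; rewrite in_itv/=.
    by move: st => /andP[/ltW -> ->].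
  have := powRN_lipschitz p_gt0 c0 cs; rewrite -/L1.
  have : 0 <= L2 * (u 0 0 - u 0 s) by rewrite mulr_ge0// subr_ge0 ltW.
  by lra.
- move=> s st; have /sT sT' := st; rewrite subr_lt0 => us.
  rewrite (sol_flux_right u_sol)// (sol_x_initial Aa) (compat_right u0_adm)
    -u0E//.
  have cs : 1 - u a 0 <= 1 - u a 0 <= 1 - u a s by rewrite lexx lerD2l lerN2
    ltW.
  have u1 : 0 < 1 - u a 0 by rewrite subr_gt0.
  have := powRN_lipschitz q_gt0 u1 cs; rewrite -/L2.
  have : 0 <= L1 * (u a 0 - u a s) by rewrite mulr_ge0// subr_ge0 ltW.
  by lra.
- by move=> y _; rewrite subrr.
Qed.

End InitialComparison.

(** * The differential inequality at [x = a] and the quenching rate *)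

Section QuenchingRate.
Context {R : realType}.
Implicit Types (x y z s t : R).
Variables (a p q T : R) (u0 : R -> R) (u : R -> R -> R).
Hypotheses (a_gt0 : 0 < a) (p_gt0 : 0 < p) (q_gt0 : 0 < q) (T_gt0 : 0 < T).
Hypothesis u0_adm : admissible_initial a p q u0.
Hypothesis u_sol : classical_solution a p q u0 T u.
Hypothesis u_xx_ge0 : forall x, 0 < x < a -> 0 <= d_xx a u x 0.
Hypothesis u_x_ge : forall x, 0 < x < a ->
  x / a * (1 - u x 0) `^ (- q) <= d_x a u x 0.

Let aa : 0 <= a <= a. Proof. by rewrite lexx ltW. Qed.
Let u0_lt1 : u0 a < 1. Proof. exact: initial_lt1_right u0_adm. Qed.

(** The potential is maximal at [x = a] with zero slope, so the one-sided second-derivative test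
    gives [potential_xx a t <= 0]; inserting this in [potential_heat] at [x = a] leaves the stated
    bound. *)
Lemma sol_flux_rate t : 0 < t < T ->
  (1 - u a t) `^ q * d_t u a t <= a^-1 + q * (1 - u a t) `^ (- (q + 1)).
Proof.
move=> tT; have tT' : 0 <= t < T by move: tT => /andP[/ltW -> ->].
rewrite (potential_heat a_gt0 u_sol u_x_ge u0_lt1) ?a_gt0 ?lexx//; last first.
  exact: (potential_x_right a_gt0 u_sol tT).
rewrite divff ?gt_eqF// expr1n mulr1 -addrA gerDr.
rewrite -oppr_ge0.
apply: (@deriv_within_min_second _ `[0, a] (fun y => - potential a q u y t)
  (fun y => - potential_x a q u y t) 0 a) => //.
- move=> y ya; apply: deriv_withinN.
  exact: (potential_deriv a_gt0 q_gt0 u_sol u_x_ge u0_lt1 ya tT').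
- move=> y /andP[y0 ya]; rewrite lerN2.
  by apply: (potential_nondecreasing a_gt0 q_gt0 u_sol u_x_ge u0_lt1) => //;
    rewrite y0.
- by rewrite (potential_x_right a_gt0 u_sol tT) oppr0.
- apply: deriv_withinN.
  exact: (potential_x_deriv a_gt0 u_sol u_x_ge u0_lt1 aa tT).
Qed.

Lemma sol_right_ge_initial t : 0 <= t < T -> 0 < u0 0 <= u a t.
Proof.
move=> tT; rewrite (initial_gt0_left u0_adm)/=.
have zz : 0 <= (0 : R) <= a by rewrite lexx ltW.
apply: (@le_trans _ _ (u 0 t)).
  rewrite -(sol_initial u_sol zz).
  exact: (sol_ge_initial a_gt0 p_gt0 q_gt0 T_gt0 u0_adm u_sol u_xx_ge0).
by apply: (sol_nondecreasing a_gt0 u_sol u_x_ge); rewrite ?lexx//= ltW.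
Qed.

Let k : R := 2 * q + 2.
Let C : R := k * (a^-1 + q).

Lemma gap_power_decrease s t : 0 < t -> t <= s -> s < T ->
  (1 - u a t) `^ k + C * t <= (1 - u a s) `^ k + C * s.
Proof.
move=> t0 ts sT; have q0 := q_gt0; have k0 : 0 < k by rewrite /k; lra.
have rT (r : R) : t <= r <= s -> 0 < r < T.
  by move=> /andP[tr rs]; rewrite (lt_le_trans t0)//= (le_lt_trans rs).
apply: (@deriv_within_nondecreasing _ `[t, s] (fun r =>
  (1 - u a r) `^ k + C * r)
  (fun r => - (k * (1 - u a r) `^ (k - 1)) * d_t u a r + C)) => //.
- move=> r /rT rT'; apply: deriv_withinD.
    have u1 := sol_lt1_right u_sol rT'.
    apply: is_derive_deriv_within.
    have := @is_derive1_comp _ (fun z => (1 - z) `^ k) (u a) r _ _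
      (is_derive_powR_onem k u1) (sol_t u_sol aa rT').
    exact.
  apply: is_derive_deriv_within.
  by apply: is_derive_eq; rewrite /GRing.scale/= ?mulr0 ?add0r mulr1.
move=> r /andP[tr rs].
have rT' : 0 < r < T by apply: rT; rewrite !ltW.
have W0 : 0 < 1 - u a r by rewrite subr_gt0; exact: (sol_lt1_right u_sol rT').
have Wn0 : 1 - u a r != 0 by rewrite gt_eqF.
(* Positivity of [u] at [a] comes from the comparison with [u0]; it makes the power [q + 1] of the
   gap at most 1. *)
have W1 : 1 - u a r <= 1.
  have /andP[? ?] : 0 < u0 0 <= u a r.
    by apply: sol_right_ge_initial; move: rT' => /andP[/ltW -> ->].
  lra.
have Wq1 : (1 - u a r) `^ (q + 1) <= 1.
  have q1 : 0 <= q + 1 by lra.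
  by have := @ge0_ler_powR _ _ q1 (1 - u a r) 1; rewrite !nnegrE powR1; apply;
    rewrite // ltW.
have -> : (1 - u a r) `^ (k - 1) = (1 - u a r) `^ (q + 1) * (1 - u a r) `^ q.
  by rewrite -powRD ?Wn0 ?implybT//; congr (_ `^ _); rewrite /k; ring.
have := sol_flux_rate rT'.
set P := (1 - u a r) `^ (q + 1) in Wq1 *.
have P0 : 0 < P by rewrite powR_gt0.
rewrite powRN -/P -(ler_pM2l P0) mulrDr (mulrCA P q) divff ?gt_eqF// mulr1 => h.
have : P * a^-1 <= a^-1 by rewrite ler_piMl// invr_ge0 ltW.
rewrite /C mulNr -!mulrA addrC -mulrBr => h2.
apply: mulr_ge0; first exact: ltW.
rewrite subr_ge0; lra.
Qed.

Lemma max_x_right t : 0 <= t < T -> max_x a u t = u a t.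
Proof.
move=> tT; rewrite /max_x.
have ubd : ubound [set u x t | x in `[0, a]] (u a t).
  move=> _ [x + <-]; rewrite /= in_itv/= => xa.
  by apply: (sol_nondecreasing a_gt0 u_sol u_x_ge).
have mem : [set u x t | x in `[0, a]] (u a t) by exists a => //=;
  rewrite in_itv.
apply/eqP; rewrite eq_le; apply/andP; split.
  by apply: sup_le_ub => //; exists (u a t).
by apply: ub_le_sup => //; exists (u a t).
Qed.

Lemma min_x_ge_initial t : 0 <= t < T -> u0 0 <= min_x a u t.
Proof.
move=> tT; have zz : 0 <= (0 : R) <= a by rewrite lexx ltW.
apply: lb_le_inf; first by exists (u 0 t), 0 => //=; rewrite in_itv.
move=> _ [x + <-]; rewrite /= in_itv/= => /andP[x0 xa].
apply: (@le_trans _ _ (u 0 t)).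
  rewrite -(sol_initial u_sol zz).
  exact: (sol_ge_initial a_gt0 p_gt0 q_gt0 T_gt0 u0_adm u_sol u_xx_ge0).
by apply: (sol_nondecreasing a_gt0 u_sol u_x_ge); rewrite ?lexx.
Qed.

Lemma near_left_time : \forall t \near T^'-, 0 < t < T.
Proof.
near=> t; apply/andP; split; last by near: t; exact: nbhs_left_lt.
by near: t; exact: nbhs_left_gt.
Unshelve. all: by end_near. Qed.

Hypothesis u_quench : quenches_at a u T.

Lemma sol_right_quenches : u a t @[t --> T^'-] --> (1 : R).
Proof.
case: u_quench => h.
  (* The minimum over space stays at least [u0 0 > 0], so it cannot tend to 0. *)
  exfalso; have e0 := initial_gt0_left u0_adm.
  move/cvgrPdist_lt : h => /(_ _ e0) h.
  have [t [/= ht /andP[t0 tT]]] := @filter_ex _ _ (at_left_proper_filter T) _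
    (filterI h near_left_time).
  have tT' : 0 <= t < T by rewrite ltW.
  have := min_x_ge_initial tT'; rewrite leNgt => /negP; apply.
  by move: ht; rewrite sub0r normrN; apply: le_lt_trans; exact: ler_norm.
apply: cvg_near_eq erefl h _.
by apply: filterS near_left_time => t /andP[/ltW t0 tT];
  rewrite max_x_right// t0.
Qed.

Lemma gap_power_bound t : 0 < t < T -> (1 - u a t) `^ k <= C * (T - t).
Proof.
move=> /andP[t0 tT]; rewrite leNgt; apply/negP => h.
have q0 := q_gt0; have k0 : 0 < k by rewrite /k; lra.
have C0 : 0 < C by rewrite mulr_gt0// addr_gt0// invr_gt0.
pose e := (1 - u a t) `^ k - C * (T - t).
have e0 : 0 < e by rewrite subr_gt0.
have d0 : 0 < e `^ k^-1 by rewrite powR_gt0.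
have /cvgrPdist_lt/(_ _ d0) near1 := sol_right_quenches.
have [s [[/= us /andP[s0 sT]] ts]] :=
  @filter_ex _ _ (at_left_proper_filter T) _
    (filterI (filterI near1 near_left_time) (nbhs_left_gt tT)).
have := gap_power_decrease t0 (ltW ts) sT.
have W0 : 0 < 1 - u a s.
  by rewrite subr_gt0; apply: (sol_lt1_right u_sol); rewrite s0.
have : (1 - u a s) `^ k < e.
  have lt_e : 1 - u a s < e `^ k^-1 by apply: le_lt_trans us; exact: ler_norm.
  have := @gt0_ltr_powR _ _ k0 (1 - u a s) (e `^ k^-1).
  rewrite !nnegrE (ltW W0) (ltW d0) -powRrM mulVf ?gt_eqF// powRr1 ?(ltW e0)//.
  exact.
have : 0 < C * (T - s) by rewrite mulr_gt0// subr_gt0.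
rewrite /e; lra.
Qed.

End QuenchingRate.

Unset Implicit Arguments.

Theorem theorem3p2 (R : realType) (a p q : R) (u0 : R -> R) (T : R)
    (u : R -> R -> R) (a_gt0 : 0 < a) (p_gt0 : 0 < p) (q_gt0 : 0 < q)
    (T_gt0 : 0 < T)
    (u0_adm : admissible_initial a p q u0)
    (u_sol : classical_solution a p q u0 T u)
    (u_quench : quenches_at a u T)
    (u_xx_ge0 : forall x, 0 < x < a -> 0 <= d_xx a u x 0)
    (u_x_ge : forall x, 0 < x < a ->
       x / a * (1 - u x 0) `^ (- q) <= d_x a u x 0) :
  exists C2 : R, 0 < C2 /\
    \forall t \near T^'-,
      1 - C2 * (T - t) `^ (1 / (2 * q + 2)) <= u a t.
Proof.
have k0 : 0 < 2 * q + 2 by lra.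
have C0 : 0 < (2 * q + 2) * (a^-1 + q) by rewrite mulr_gt0// addr_gt0//
  invr_gt0.
(* [C2] is the root of order [2 * q + 2] of the constant in [gap_power_bound], as one takes that
   root on both sides. *)
exists (((2 * q + 2) * (a^-1 + q)) `^ (1 / (2 * q + 2))); split.
  exact: powR_gt0.
apply: filterS (near_left_time T_gt0) => t tT.
have := gap_power_bound a_gt0 p_gt0 q_gt0 T_gt0 u0_adm u_sol u_xx_ge0 u_x_ge
  u_quench tT.
have Tt : 0 < T - t by rewrite subr_gt0; move: tT => /andP[].
have W0 : 0 < 1 - u a t by rewrite subr_gt0; exact: (sol_lt1_right u_sol tT).
have r0 : 0 <= 1 / (2 * q + 2) by rewrite divr_ge0// ltW.
move=> /(ge0_ler_powR r0); rewrite !nnegrE powR_ge0 => /(_ erefl).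
rewrite mulr_ge0 ?(ltW C0) ?(ltW Tt)// => /(_ erefl).
rewrite -powRrM [(2 * q + 2) * _]mulrC divfK ?gt_eqF// powRr1 ?(ltW W0)//.
rewrite powRM ?(ltW C0) ?(ltW Tt)//; lra.
Qed.
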